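(* Let $W$ be a prewedge with its preorder $\le_s$, $J$ a cone with joins with order $\le_t$, $\varphi:W\to J$ superadditive and $\psi:W\to J$ subadditive. Let $W'\subset W$ be a subwedge and $M:W'\to J$ linear such that for all $a,c\in W'$ and $b,d\in W$, $$a+b\le_s c+d\quad\Longrightarrow\quad M(a)+\varphi(b)\le_t M(c)+\psi(d).$$ Then there exists a linear map $\hat M:W\to J$ extending $M$ such that $\varphi(v)\le_t\hat M(v)\le_t\psi(v)$ for all $v\in W$.
   Context: A prewedge is a set $W$ with a commutative associative addition with neutral element $0$ and a multiplication $[0,\infty)\times W\to W$ such that $\lambda(\eta v)=(\lambda\eta)v$, $0v=0$, $1v=v$, $(\lambda+\eta)v=\lambda v+\eta v$, $\lambda(v+w)=\lambda v+\lambda w$; it carries the preorder $v\le w$ iff $v+z=w$ for some $z$. A subwedge is a subset closed under sum and multiplication by nonnegative scalars. A wedge is a prewedge in which $\le$ is antisymmetric and $v=\sup_{\eta<1}\eta v$ for every $v$. A cone is a wedge in which every directed subset has a supremum. A cone with joins is a cone $J$ in which every subset $A$ has an infimum and $\inf(v+A)=v+\inf A$ for all $v\in J$, $A\subset J$. A map $L$ from a prewedge to a wedge with $L(0)=0$ is superadditive if $L(\lambda_1v_1+\lambda_2v_2)\ge\lambda_1L(v_1)+\lambda_2L(v_2)$ for all $\lambda_i\in[0,\infty)$ and $v_i$; subadditive if the reverse inequality holds; linear if both hold. *)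

(* Defs.v *)
From Stdlib Require Import Reals.
Open Scope R_scope.
Set Implicit Arguments.

(* A prewedge: commutative monoid with an action of [0,oo).  The scalar
   multiplication is a total function R -> W -> W, but all axioms (and all
   later uses) only concern nonnegative scalars. *)
Record prewedge := Prewedge {
  pw_car :> Type;
  pw_add : pw_car -> pw_car -> pw_car;
  pw_zero : pw_car;
  pw_smul : R -> pw_car -> pw_car;
  pw_addC : forall v w, pw_add v w = pw_add w v;
  pw_addA : forall u v w, pw_add u (pw_add v w) = pw_add (pw_add u v) w;
  pw_add0 : forall v, pw_add pw_zero v = v;
  pw_smulA : forall l e v, 0 <= l -> 0 <= e ->
      pw_smul l (pw_smul e v) = pw_smul (l * e) v;
  pw_smul0 : forall v, pw_smul 0 v = pw_zero;
  pw_smul1 : forall v, pw_smul 1 v = v;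
  pw_smulDl : forall l e v, 0 <= l -> 0 <= e ->
      pw_smul (l + e) v = pw_add (pw_smul l v) (pw_smul e v);
  pw_smulDr : forall l v w, 0 <= l ->
      pw_smul l (pw_add v w) = pw_add (pw_smul l v) (pw_smul l w)
}.

Arguments pw_add {p}.
Arguments pw_zero {p}.
Arguments pw_smul {p}.

Definition pw_le {W : prewedge} (v w : W) : Prop := exists z, pw_add v z = w.

Definition is_sup {W : prewedge} (S : W -> Prop) (s : W) : Prop :=
  (forall x, S x -> pw_le x s) /\
  (forall u, (forall x, S x -> pw_le x u) -> pw_le s u).

Definition is_inf {W : prewedge} (S : W -> Prop) (i : W) : Prop :=
  (forall x, S x -> pw_le i x) /\
  (forall u, (forall x, S x -> pw_le u x) -> pw_le u i).

Definition is_wedge (W : prewedge) : Prop :=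
  (forall v w : W, pw_le v w -> pw_le w v -> v = w) /\
  (forall v : W, @is_sup W (fun x => exists eta, 0 <= eta < 1 /\ x = pw_smul eta v) v).

Definition directed {W : prewedge} (D : W -> Prop) : Prop :=
  (exists x, D x) /\
  (forall x y, D x -> D y -> exists z, D z /\ pw_le x z /\ pw_le y z).

Definition is_cone (W : prewedge) : Prop :=
  is_wedge W /\ forall D : W -> Prop, directed D -> exists s, is_sup D s.

Definition is_cone_with_joins (J : prewedge) : Prop :=
  is_cone J /\
  (forall A : J -> Prop, exists i, is_inf A i) /\
  (forall (v : J) (A : J -> Prop) (i : J), is_inf A i ->
      @is_inf J (fun x => exists a, A a /\ x = pw_add v a) (pw_add v i)).

Definition subwedge {W : prewedge} (P : W -> Prop) : Prop :=
  P pw_zero /\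
  (forall v w, P v -> P w -> P (pw_add v w)) /\
  (forall l v, 0 <= l -> P v -> P (pw_smul l v)).

Definition superadditive_on {W J : prewedge} (P : W -> Prop) (L : W -> J) : Prop :=
  L pw_zero = pw_zero /\
  forall l1 l2 v1 v2, 0 <= l1 -> 0 <= l2 -> P v1 -> P v2 ->
    pw_le (pw_add (pw_smul l1 (L v1)) (pw_smul l2 (L v2)))
          (L (pw_add (pw_smul l1 v1) (pw_smul l2 v2))).

Definition subadditive_on {W J : prewedge} (P : W -> Prop) (L : W -> J) : Prop :=
  L pw_zero = pw_zero /\
  forall l1 l2 v1 v2, 0 <= l1 -> 0 <= l2 -> P v1 -> P v2 ->
    pw_le (L (pw_add (pw_smul l1 v1) (pw_smul l2 v2)))
          (pw_add (pw_smul l1 (L v1)) (pw_smul l2 (L v2))).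

Definition linear_on {W J : prewedge} (P : W -> Prop) (L : W -> J) : Prop :=
  superadditive_on P L /\ subadditive_on P L.

Definition is_superadditive {W J : prewedge} (L : W -> J) := superadditive_on (fun _ => True) L.
Definition is_subadditive {W J : prewedge} (L : W -> J) := subadditive_on (fun _ => True) L.
Definition is_linear {W J : prewedge} (L : W -> J) := linear_on (fun _ => True) L.

(* Main.v *)
Require Import Defs.
From Stdlib Require Import Reals Lra ssreflect.
From mathcomp Require boolp classical_sets.

(** [M] is extended one vector [w] at a time, Zorn's lemma doing the rest.  The
    value [x] at [w] is the least element of [J] satisfying all the lower bounds
    that the domination hypothesis imposes on it; it exists because infima
    commute with addition.  For the remaining inequalities one needs a
    substitute for subtraction: if [v <= u], then there is [z] with [v + z = u]
    such that [v + s <= u + t] implies [s <= z + t], namely [z = z0 + o] with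
    [v + z0 = u] and [o = inf_(e > 0) e v].  Applied to the two sides of an
    inequality to be proved, this produces a [z] that satisfies all the lower
    bounds, hence [x <= z]. *)

Declare Scope prewedge_scope.
Local Open Scope prewedge_scope.
Local Infix "⊕" := pw_add (at level 50, left associativity) : prewedge_scope.
Local Infix "⊙" := pw_smul (at level 40) : prewedge_scope.
Local Infix "⊑" := pw_le (at level 70) : prewedge_scope.

(** * Order and arithmetic in prewedges *)

Lemma addr0 (W : prewedge) (v : W) : v ⊕ pw_zero = v.
Proof. by rewrite pw_addC pw_add0. Qed.

Lemma addAC (W : prewedge) (u v w : W) : u ⊕ v ⊕ w = u ⊕ w ⊕ v.
Proof. by rewrite -!pw_addA (pw_addC W v). Qed.

Lemma addACA (W : prewedge) (u v w z : W) : u ⊕ v ⊕ (w ⊕ z) = u ⊕ w ⊕ (v ⊕ z).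
Proof. by rewrite !pw_addA (addAC _ u v). Qed.

Lemma smulr0 (W : prewedge) (l : R) : 0 <= l -> l ⊙ pw_zero = pw_zero :> W.
Proof.
move=> l0; rewrite -(pw_smul0 W pw_zero) pw_smulA ?Rmult_0_r //; lra.
Qed.

Lemma le_refl (W : prewedge) (v : W) : v ⊑ v.
Proof. by exists pw_zero; rewrite addr0. Qed.

Lemma le_trans (W : prewedge) (v u w : W) : u ⊑ v -> v ⊑ w -> u ⊑ w.
Proof. by move=> [y <-] [z <-]; exists (y ⊕ z); rewrite pw_addA. Qed.

Lemma le_addr (W : prewedge) (v w : W) : v ⊑ v ⊕ w.
Proof. by exists w. Qed.

Lemma le_add (W : prewedge) (u v w z : W) : u ⊑ v -> w ⊑ z -> u ⊕ w ⊑ v ⊕ z.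
Proof. by move=> [a <-] [b <-]; exists (a ⊕ b); rewrite addACA. Qed.

Lemma le_add2l (W : prewedge) (u v w : W) : v ⊑ w -> u ⊕ v ⊑ u ⊕ w.
Proof. by apply: le_add; apply: le_refl. Qed.

Lemma le_add2r (W : prewedge) (u v w : W) : v ⊑ w -> v ⊕ u ⊑ w ⊕ u.
Proof. by move=> vw; apply: le_add => //; apply: le_refl. Qed.

Lemma le_smul (W : prewedge) (l : R) (v w : W) : 0 <= l -> v ⊑ w -> l ⊙ v ⊑ l ⊙ w.
Proof. by move=> l0 [z <-]; rewrite pw_smulDr //; apply: le_addr. Qed.

Lemma smulVK (W : prewedge) (l : R) (v : W) : 0 < l -> / l ⊙ (l ⊙ v) = v.
Proof.
move=> l0; have := Rinv_0_lt_compat _ l0 => il0.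
rewrite pw_smulA ?Rinv_l ?pw_smul1 //; lra.
Qed.

Lemma le_smul_cancel (W : prewedge) (l : R) (v w : W) :
  0 < l -> l ⊙ v ⊑ l ⊙ w -> v ⊑ w.
Proof.
move=> l0 lvw; rewrite -(smulVK W l v) // -(smulVK W l w) //.
by apply: le_smul => //; apply/Rlt_le/Rinv_0_lt_compat.
Qed.

Lemma le_smull (W : prewedge) (l e : R) (v : W) :
  0 <= l -> l <= e -> l ⊙ v ⊑ e ⊙ v.
Proof.
move=> l0 le; exists ((e - l) ⊙ v).
rewrite -pw_smulDl ?Rplus_minus //; lra.
Qed.

Lemma le_smul1 (W : prewedge) (l : R) (v : W) : 0 <= l -> l <= 1 -> l ⊙ v ⊑ v.
Proof. by move=> l0 l1; have := le_smull W l 1 v l0 l1; rewrite pw_smul1. Qed.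

Lemma superadditive_add (W J : prewedge) (L : W -> J) (v w : W) :
  is_superadditive L -> L v ⊕ L w ⊑ L (v ⊕ w).
Proof.
move=> [_ /(_ 1 1 v w)]; rewrite !pw_smul1; apply=> //; exact: Rle_0_1.
Qed.

Lemma superadditive_smul (W J : prewedge) (L : W -> J) (l : R) (v : W) :
  is_superadditive L -> 0 <= l -> l ⊙ L v ⊑ L (l ⊙ v).
Proof.
move=> [_ /(_ l 0 v v) + l0]; rewrite !pw_smul0 !addr0; apply=> //; exact: Rle_refl.
Qed.

Lemma subadditive_add (W J : prewedge) (L : W -> J) (v w : W) :
  is_subadditive L -> L (v ⊕ w) ⊑ L v ⊕ L w.
Proof.
move=> [_ /(_ 1 1 v w)]; rewrite !pw_smul1; apply=> //; exact: Rle_0_1.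
Qed.

Lemma subadditive_smul (W J : prewedge) (L : W -> J) (l : R) (v : W) :
  is_subadditive L -> 0 <= l -> L (l ⊙ v) ⊑ l ⊙ L v.
Proof.
move=> [_ /(_ l 0 v v) + l0]; rewrite !pw_smul0 !addr0; apply=> //; exact: Rle_refl.
Qed.

(** * Cancellation in cones with joins *)

Lemma le_antisym (J : prewedge) (v w : J) :
  is_cone_with_joins J -> v ⊑ w -> w ⊑ v -> v = w.
Proof. by move=> [[[anti _] _] _]; apply: anti. Qed.

(** The infinite part of [v]: in [[0, oo]] it is [0] for finite [v] and [oo] for [v = oo]. *)
Definition is_recession {J : prewedge} (v o : J) : Prop :=
  @is_inf J (fun x => exists e, 0 < e /\ x = e ⊙ v) o.

(** For [e < 1], [e (v + o) <= e v + o <= e v + (1 - e) v = v]; now take the supremum over [e]. *)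
Lemma recession_absorb (J : prewedge) (v o : J) :
  is_cone_with_joins J -> is_recession v o -> v ⊕ o = v.
Proof.
move=> HJ [lb _]; apply: (le_antisym J _ _ HJ); last exact: le_addr.
have [[[_ /(_ (v ⊕ o)) [_ lub]] _] _] := HJ.
apply: lub => _ [e [[e0 e1] ->]].
apply: (le_trans J (e ⊙ v ⊕ o)).
  rewrite pw_smulDr //; apply: le_add2l.
  by apply: le_smul1 => //; exact: Rlt_le.
apply: (le_trans J (e ⊙ v ⊕ (1 - e) ⊙ v)).
  by apply: le_add2l; apply: lb; exists (1 - e); split=> //; lra.
by rewrite -pw_smulDl ?Rplus_minus ?pw_smul1; [exact: le_refl|lra|lra].
Qed.

(** A single copy of [v] serves as a catalyst that turns the [n] copies of [s] into [t] one after
    another. *)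
Lemma le_add_iter (W : prewedge) (v s t : W) (n : nat) :
  v ⊕ s ⊑ v ⊕ t -> v ⊕ INR n ⊙ s ⊑ v ⊕ INR n ⊙ t.
Proof.
move=> st; elim: n => [|n IH]; first by rewrite !pw_smul0; apply: le_refl.
have n0 := pos_INR n; have le01 := Rle_0_1.
rewrite S_INR !pw_smulDl // !pw_smul1 !pw_addA.
apply: (le_trans W (v ⊕ INR n ⊙ t ⊕ s)); first exact: le_add2r.
by rewrite !(addAC _ v (INR n ⊙ t)); apply: le_add2r.
Qed.

(** Iterating gives [n s <= v + n t]. Division by [n] leaves an error [v / n], which is below [e v]
    for large [n]; the infimum over [e] commutes with adding [t]. *)
Lemma le_add_cancel (J : prewedge) (v o s t : J) :
  is_cone_with_joins J -> is_recession v o -> v ⊕ s ⊑ v ⊕ t -> s ⊑ t ⊕ o.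
Proof.
move=> [_ [_ addinf]] inf_o st.
have [_ glb] := addinf t _ _ inf_o.
apply: glb => _ [_ [[e [e0 ->]] ->]].
have [n [en n0]] := archimed_cor1 e e0.
have {}n0 : 0 < INR n by apply: lt_0_INR.
apply: (le_smul_cancel J (INR n)) => //.
apply: (le_trans J (v ⊕ INR n ⊙ s)); first by rewrite pw_addC; apply: le_addr.
apply: (le_trans J _ _ _ (le_add_iter J v s t n st)).
have [n0' e0'] := (Rlt_le _ _ n0, Rlt_le _ _ e0).
rewrite pw_addC pw_smulDr // pw_smulA //; apply: le_add2l.
have ne : 1 <= INR n * e.
  rewrite -(Rinv_r (INR n)); last lra.
  by apply: Rmult_le_compat_l; lra.
by have := le_smull J 1 (INR n * e) v Rle_0_1 ne; rewrite pw_smul1.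
Qed.

(** The summand [o] is the error term of [le_add_cancel], and it is harmless in [v + z] because [v]
    absorbs it. *)
Lemma residual (J : prewedge) (u v : J) : is_cone_with_joins J -> v ⊑ u ->
  exists z, v ⊕ z = u /\ forall s t, v ⊕ s ⊑ u ⊕ t -> s ⊑ z ⊕ t.
Proof.
move=> HJ [z <-]; have [_ [exinf _]] := HJ.
have [o inf_o] := exinf (fun x => exists e, 0 < e /\ x = e ⊙ v).
exists (z ⊕ o); split.
  by rewrite pw_addA addAC (recession_absorb J v o HJ inf_o).
move=> s t; rewrite -pw_addA addAC; exact: le_add_cancel.
Qed.

(** * Graphs in the product, and adjoining one vector *)

Definition prod_prewedge (W J : prewedge) : prewedge.
Proof.
refine (@Prewedge (W * J)%type
  (fun p q => (fst p ⊕ fst q, snd p ⊕ snd q)) (pw_zero, pw_zero)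
  (fun l p => (l ⊙ fst p, l ⊙ snd p)) _ _ _ _ _ _ _ _).
- by move=> p q; rewrite (pw_addC W (fst p)) (pw_addC J (snd p)).
- by move=> p q r; rewrite /= !pw_addA.
- by move=> [v x]; rewrite !pw_add0.
- by move=> l e p l0 e0; rewrite /= !pw_smulA.
- by move=> p; rewrite !pw_smul0.
- by move=> [v x]; rewrite !pw_smul1.
- by move=> l e p l0 e0; rewrite !pw_smulDl.
- by move=> l p q l0; rewrite !pw_smulDr.
Defined.

Definition adjoin {W : prewedge} (G : W -> Prop) (w : W) : W -> Prop :=
  fun v => exists g l, G g /\ 0 <= l /\ v = g ⊕ l ⊙ w.

Lemma subwedge_adjoin (W : prewedge) (G : W -> Prop) (w : W) :
  subwedge G -> subwedge (adjoin G w).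
Proof.
move=> [G0 [GD GZ]]; split; [|split].
- exists pw_zero, 0; split=> //; split; first exact: Rle_refl.
  by rewrite pw_smul0 addr0.
- move=> _ _ [g [l [Gg [l0 ->]]]] [h [k [Gh [k0 ->]]]].
  exists (g ⊕ h), (l + k); split; [exact: GD|split; first lra].
  by rewrite pw_smulDl // addACA.
- move=> k _ k0 [g [l [Gg [l0 ->]]]].
  exists (k ⊙ g), (k * l); split; [exact: GZ|split; first exact: Rmult_le_pos].
  by rewrite pw_smulDr // pw_smulA.
Qed.

Lemma sub_adjoin (W : prewedge) (G : W -> Prop) (w g : W) : G g -> adjoin G w g.
Proof.
by exists g, 0; split=> //; split; [exact: Rle_refl|rewrite pw_smul0 addr0].
Qed.

Lemma adjoin_new (W : prewedge) (G : W -> Prop) (w : W) :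
  subwedge G -> adjoin G w w.
Proof.
move=> [G0 _]; exists pw_zero, 1; split=> //.
by split; [exact: Rle_0_1|rewrite pw_smul1 pw_add0].
Qed.

Definition dominated {W J : prewedge} (phi psi : W -> J) (p q : prod_prewedge W J) :=
  forall b d, fst p ⊕ b ⊑ fst q ⊕ d -> snd p ⊕ phi b ⊑ snd q ⊕ psi d.

(* A subwedge of [W * J] all of whose pairs are dominated is the graph of a
   partial linear map; working with graphs makes unions of chains immediate. *)
Definition sandwiched {W J : prewedge} (phi psi : W -> J)
    (G : prod_prewedge W J -> Prop) : Prop :=
  subwedge G /\ forall p q, G p -> G q -> dominated phi psi p q.

(** This normalizes the coefficient of the new vector on one side to 1. *)
Lemma dominated_smul (W J : prewedge) (phi psi : W -> J) (k : R)
    (p q : prod_prewedge W J) :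
  is_superadditive phi -> is_subadditive psi -> 0 < k ->
  dominated phi psi (k ⊙ p) (k ⊙ q) -> dominated phi psi p q.
Proof.
move=> Hphi Hpsi k0 dom b d bd; have k0' := Rlt_le _ _ k0.
apply: (le_smul_cancel J k) => //.
rewrite !pw_smulDr //.
apply: (le_trans J (k ⊙ snd p ⊕ phi (k ⊙ b))).
  by apply: le_add2l; apply: superadditive_smul.
apply: (le_trans J (k ⊙ snd q ⊕ psi (k ⊙ d))).
  by apply: dom; rewrite /= -!pw_smulDr //; apply: le_smul.
by apply: le_add2l; apply: subadditive_smul.
Qed.

Lemma sandwiched_adjoin (W J : prewedge) (phi psi : W -> J)
    (G : prod_prewedge W J -> Prop) (w : W) :
  is_cone_with_joins J -> is_superadditive phi -> is_subadditive psi ->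
  sandwiched phi psi G -> exists x : J, sandwiched phi psi (adjoin G (w, x)).
Proof.
move=> HJ Hphi Hpsi [Gsub Gdom]; have [G0 [GD GZ]] := Gsub.
(* Only the constraints with [w] once on the right and not on the left; all others will follow. *)
pose S x := forall p q, G p -> G q ->
  dominated phi psi p (q ⊕ ((w, x) : prod_prewedge W J)).
have [_ [exinf addinf]] := HJ.
have [x inf_x] := exinf S.
have Sx : S x.
  (* Each constraint bounds a translate of [x] from below, so it passes to the infimum. *)
  move=> p q Gp Gq b d bd /=.
  rewrite addAC; have [_ glb] := addinf (snd q ⊕ psi d) _ _ inf_x.
  apply: glb => _ [y [Sy ->]]; rewrite addAC; exact: Sy.
have [xlb _] := inf_x.
exists x; split; first exact: subwedge_adjoin.
pose r : prod_prewedge W J := (w, x).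
have dom0 m p q : 0 <= m -> G p -> G q -> dominated phi psi p (q ⊕ m ⊙ r).
  move=> [m0|<-] Gp Gq; last by rewrite pw_smul0 addr0; apply: Gdom.
  have im0 := Rinv_0_lt_compat _ m0; have im0' := Rlt_le _ _ im0.
  apply: (dominated_smul W J phi psi (/ m)) => //.
  rewrite pw_smulDr // smulVK //.
  by apply: Sx; apply: GZ.
have dom1 m p q : 0 <= m -> G p -> G q -> dominated phi psi (p ⊕ r) (q ⊕ m ⊙ r).
  move=> m0 Gp Gq b d bd.
  have bd0 : fst p ⊕ b ⊑ fst (q ⊕ m ⊙ r) ⊕ d.
    by apply: (le_trans W _ _ _ _ bd); rewrite /= addAC; apply: le_addr.
  (* Dropping [w] on the left gave a case of [dom0]. Its slack [z] must leave room for [x]; as [x]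
     is the infimum of [S], it suffices that [z] lies in [S]. *)
  have [z [vz zres]] := residual J _ _ HJ (dom0 m p q m0 Gp Gq b d bd0).
  rewrite -vz [snd (p ⊕ r) ⊕ _]addAC; apply: le_add2l.
  apply: xlb => p' q' Gp' Gq' b' d' bd' /=.
  rewrite (pw_addC J (snd q')) -pw_addA; apply: zres.
  rewrite [X in X ⊑ _]addACA.
  apply: (le_trans J (snd (p ⊕ p') ⊕ phi (b ⊕ b'))).
    by apply: le_add2l; apply: superadditive_add.
  apply: (le_trans J (snd (q ⊕ q' ⊕ m ⊙ r) ⊕ psi (d ⊕ d'))).
    (* The [w] on the right of [bd'] is the one on the left of [bd]: chaining the two eliminates it,
       leaving an inequality with no [w] on the left. *)
    apply: dom0 => //; [exact: GD|exact: GD|].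
    rewrite [fst _ ⊕ _ in X in X ⊑ _]addACA.
    apply: (le_trans W (fst p ⊕ b ⊕ (fst q' ⊕ w ⊕ d'))); first exact: le_add2l.
    rewrite [fst q' ⊕ w ⊕ _]addAC (pw_addC W _ w) pw_addA.
    have -> : fst (q ⊕ q' ⊕ m ⊙ r) ⊕ (d ⊕ d') =
              fst (q ⊕ m ⊙ r) ⊕ d ⊕ (fst q' ⊕ d').
      by rewrite [X in _ = X]addACA (addAC _ q).
    by apply: le_add2r; rewrite addAC.
  rewrite (addAC _ q) [X in _ ⊑ X]addACA.
  by apply: le_add2l; apply: subadditive_add.
move=> _ _ [p [l [Gp [l0 ->]]]] [q [m [Gq [m0 ->]]]].
case: l0 => [l0|<-]; last by rewrite pw_smul0 addr0; apply: dom0.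
have il0 := Rinv_0_lt_compat _ l0; have il0' := Rlt_le _ _ il0.
apply: (dominated_smul W J phi psi (/ l)) => //.
rewrite !pw_smulDr // smulVK // pw_smulA //.
by apply: dom1; [exact: Rmult_le_pos|exact: GZ|exact: GZ].
Qed.

(** Domination with [b = d = 0] compares two values over the same vector, in both directions. *)
Lemma sandwiched_functional (W J : prewedge) (phi psi : W -> J)
    (G : prod_prewedge W J -> Prop) (v : W) (x y : J) :
  is_cone_with_joins J -> phi pw_zero = pw_zero -> psi pw_zero = pw_zero ->
  sandwiched phi psi G -> G (v, x) -> G (v, y) -> x = y.
Proof.
move=> HJ phi0 psi0 [_ Gdom] Gx Gy.
have le_xy p q : G p -> G q -> fst p = fst q -> snd p ⊑ snd q.
  move=> Gp Gq pq; have := Gdom p q Gp Gq pw_zero pw_zero.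
  rewrite phi0 psi0 !addr0 pq; apply; exact: le_refl.
apply: (le_antisym J _ _ HJ); [exact: (le_xy _ _ Gx Gy)|exact: (le_xy _ _ Gy Gx)].
Qed.

(** * From the given map to a total graph *)

Definition graph_on {W J : prewedge} (P : W -> Prop) (M : W -> J) :
    prod_prewedge W J -> Prop :=
  fun p => P (fst p) /\ snd p = M (fst p).

Lemma linear_on_eq (W J : prewedge) (P : W -> Prop) (M : W -> J) (l k : R) (v w : W) :
  is_cone_with_joins J -> linear_on P M -> 0 <= l -> 0 <= k -> P v -> P w ->
  M (l ⊙ v ⊕ k ⊙ w) = l ⊙ M v ⊕ k ⊙ M w.
Proof.
move=> HJ [[_ sup] [_ sub]] l0 k0 Pv Pw.
by apply: (le_antisym J _ _ HJ); [apply: sub|apply: sup].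
Qed.

Lemma subwedge_graph (W J : prewedge) (P : W -> Prop) (M : W -> J) :
  is_cone_with_joins J -> subwedge P -> linear_on P M -> subwedge (graph_on P M).
Proof.
move=> HJ [P0 [PD PZ]] HM; split; [|split].
- by split=> //=; case: HM => [[-> _] _].
- move=> [v x] [w y] [/= Pv ->] [/= Pw ->]; split=> /=; first exact: PD.
  have := linear_on_eq W J P M 1 1 v w HJ HM Rle_0_1 Rle_0_1 Pv Pw.
  by rewrite !pw_smul1 => ->.
- move=> l [v x] l0 [/= Pv ->]; split=> /=; first exact: PZ.
  have := linear_on_eq W J P M l 0 v v HJ HM l0 (Rle_refl 0) Pv Pv.
  by rewrite !pw_smul0 !addr0 => ->.
Qed.

(** Each closure or domination condition involves at most two pairs, and these lie in a common
    member of the chain. Nonemptiness supplies the zero pair. *)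
Lemma sandwiched_bigcup (W J : prewedge) (phi psi : W -> J)
    (F : (prod_prewedge W J -> Prop) -> Prop) :
  (exists X, F X) ->
  (forall X, F X -> sandwiched phi psi X) ->
  (forall X Y, F X -> F Y -> (forall p, X p -> Y p) \/ (forall p, Y p -> X p)) ->
  sandwiched phi psi (fun p => exists X, F X /\ X p).
Proof.
move=> [X0 FX0] Fsand Ftot.
have common p q : (exists X, F X /\ X p) -> (exists X, F X /\ X q) ->
    exists X, F X /\ X p /\ X q.
  move=> [X [FX Xp]] [Y [FY Yq]].
  by case: (Ftot X Y FX FY) => sub; [exists Y|exists X];
    split=> //; split=> //; apply: sub.
split; [split; [|split]|].
- by exists X0; split=> //; have [[]] := Fsand _ FX0.
- move=> p q Up Uq; have [X [FX [Xp Xq]]] := common p q Up Uq.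
  by exists X; split=> //; have [[_ [XD _]] _] := Fsand _ FX; apply: XD.
- move=> l p l0 [X [FX Xp]].
  by exists X; split=> //; have [[_ [_ XZ]] _] := Fsand _ FX; apply: XZ.
- move=> p q Up Uq; have [X [FX [Xp Xq]]] := common p q Up Uq.
  by have [_ dom] := Fsand _ FX; apply: dom.
Qed.

(** A maximal sandwiched graph is total, since adjoining a missing vector would enlarge it. *)
Lemma sandwiched_total_extension (W J : prewedge) (phi psi : W -> J)
    (G0 : prod_prewedge W J -> Prop) :
  is_cone_with_joins J -> is_superadditive phi -> is_subadditive psi ->
  sandwiched phi psi G0 ->
  exists G, (forall p, G0 p -> G p) /\ sandwiched phi psi G /\
    forall v, exists x, G (v, x).
Proof.
move=> HJ Hphi Hpsi sand0.
(* Adding [G0] to every set makes the empty chain harmless. *)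
pose U (A : prod_prewedge W J -> Prop) p := G0 p \/ A p.
have [F Fsand Ftot|A [Asand Amax]] :=
    classical_sets.Zorn_bigcup (P := fun A => sandwiched phi psi (U A)).
  have [[X0 FX0]|Fempty] := boolp.EM (exists X, F X); last first.
    suff -> : U (classical_sets.bigcup F (fun X => X)) = G0 by [].
    apply: boolp.funext => p; apply: boolp.propext; split; last by left.
    by case=> // -[X FX _]; case: Fempty; exists X.
  have -> : U (classical_sets.bigcup F (fun X => X)) =
      fun p => exists Y, (exists X, F X /\ Y = U X) /\ Y p.
    apply: boolp.funext => p; apply: boolp.propext; split.
      case=> [G0p|[X FX Xp]]; first by exists (U X0); split; [exists X0|left].
      by exists (U X); split; [exists X|right].
    move=> [_ [[X [FX ->]] [G0p|Xp]]]; [by left|by right; exists X].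
  apply: sandwiched_bigcup.
  - by exists (U X0), X0.
  - by move=> _ [X [FX ->]]; apply: Fsand.
  - move=> _ _ [X [FX ->]] [Y [FY ->]].
    by case: (Ftot X Y FX FY) => sub; [left|right] => p [G0p|/sub];
      [left|right|left|right].
exists (U A); split; first by left.
split=> // v; have [x Hx] := sandwiched_adjoin W J phi psi _ v HJ Hphi Hpsi Asand.
exists x; apply: boolp.contrapT => nvx.
have [Asub _] := Asand.
apply: (Amax (adjoin (U A) (v, x))).
  split; first by move=> p Ap; apply: sub_adjoin; right.
  by move=> sub; apply: nvx; right; apply: sub; apply: adjoin_new.
suff -> : U (adjoin (U A) (v, x)) = adjoin (U A) (v, x) by [].
apply: boolp.funext => p; apply: boolp.propext; split; last by right.
by case=> // G0p; apply: sub_adjoin; left.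
Qed.

Theorem mainTheorem13 (W J : prewedge) (HJ : is_cone_with_joins J)
  (phi psi : W -> J) (Hphi : is_superadditive phi) (Hpsi : is_subadditive psi)
  (W' : W -> Prop) (HW' : subwedge W') (M : W -> J) (HM : linear_on W' M)
  (Hdom : forall a c b d : W, W' a -> W' c ->
     pw_le (pw_add a b) (pw_add c d) ->
     pw_le (pw_add (M a) (phi b)) (pw_add (M c) (psi d))) :
  exists Mhat : W -> J,
    is_linear Mhat /\
    (forall a, W' a -> Mhat a = M a) /\
    (forall v, pw_le (phi v) (Mhat v) /\ pw_le (Mhat v) (psi v)).
Proof.
have sand0 : sandwiched phi psi (graph_on W' M).
  split; first exact: subwedge_graph.
  by move=> [a x] [c y] [/= Wa ->] [/= Wc ->] b d; apply: Hdom.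
have [G [subG [Gsand Gtot]]] :=
  sandwiched_total_extension W J phi psi _ HJ Hphi Hpsi sand0.
have [L GL] := boolp.choice Gtot.
have [[G0 [GD GZ]] Gdom] := Gsand.
have [[phi0 _] [psi0 _]] := (Hphi, Hpsi).
(* The chosen [L] is the only function with graph in [G], so the closure of [G] under sums and
   multiples makes it linear. *)
have LE v x : G (v, x) -> L v = x.
  by apply: (sandwiched_functional W J phi psi G) => //; apply: GL.
have L0 : L pw_zero = pw_zero by apply: LE.
have Llin l k v w : 0 <= l -> 0 <= k ->
    L (l ⊙ v ⊕ k ⊙ w) = l ⊙ L v ⊕ k ⊙ L w.
  move=> l0 k0; apply: LE.
  exact: (GD _ _ (GZ l (v, L v) l0 (GL v)) (GZ k (w, L w) k0 (GL w))).
exists L; split; [|split].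
- by split; split=> // l k v w l0 k0 _ _; rewrite Llin //; apply: le_refl.
- by move=> a Wa; apply/LE/subG.
- move=> v; split.
    (* Both bounds compare the zero pair with [(v, L v)]: from [0 + v <= v + 0] for [phi], and from
       [v + 0 <= 0 + v] for [psi]. *)
    have := Gdom _ _ G0 (GL v) v pw_zero; rewrite /= psi0 !pw_add0 !addr0.
    by apply; apply: le_refl.
  have := Gdom _ _ (GL v) G0 pw_zero v; rewrite /= phi0 !pw_add0 !addr0.
  by apply; apply: le_refl.
Qed.
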